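(* Let $(E,\rho)$ be a local pointed metric space. Then $\mathrm{SA}(E)$ is weakly sequentially dense in $\mathrm{Lip}_0(E)$, i.e. for every $g\in\mathrm{Lip}_0(E)$ there is a sequence $\{g_n\}$ in $\mathrm{SA}(E)$ which converges to $g$ in the weak topology of the Banach space $\mathrm{Lip}_0(E)$.
   Context: A pointed metric space is a metric space $(E,\rho)$ with a distinguished point $0\in E$; it is always assumed that $E\setminus\{0\}\neq\emptyset$. $\mathrm{Lip}_0(E)$ is the real Banach space of all Lipschitz functions $f:E\to\mathbb{R}$ with $f(0)=0$, with norm $\|f\|=\sup\left\{\frac{|f(x)-f(y)|}{\rho(x,y)}: x,y\in E,\ x\neq y\right\}$. A functional $f\in\mathrm{Lip}_0(E)$ attains its norm in the strong sense if there are $x,y\in E$, $x\neq y$, with $\|f\|=\frac{|f(x)-f(y)|}{\rho(x,y)}$; the set of all such $f$ is denoted $\mathrm{SA}(E)$. The pointed metric space $E$ is local if for every $\varepsilon>0$ and every $f\in\mathrm{Lip}_0(E)$ there are two distinct points $t_1,t_2\in E$ such that $\rho(t_1,t_2)<\varepsilon$ and $\frac{f(t_2)-f(t_1)}{\rho(t_1,t_2)}>\|f\|-\varepsilon$. *)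

(* Defs.v *)
From HB Require Import structures.
From mathcomp Require Import all_boot all_order all_algebra.
From mathcomp Require Import all_classical all_reals all_analysis.
From mathcomp Require Import ring.

Set Implicit Arguments.
Unset Strict Implicit.
Unset Printing Implicit Defensive.

Import Order.TTheory GRing.Theory Num.Theory.
Import numFieldNormedType.Exports.

Local Open Scope classical_set_scope.
Local Open Scope ring_scope.

Section lip0.
Context {R : realType} (E : metricType R) (o : E).

(* The library's [lipschitz] requires a normed module as domain. *)
Definition is_lipschitz (f : E -> R) : Prop :=
  exists K : R, forall x y : E, `|f x - f y| <= K * mdist x y.

Definition lip0_pred : {pred (E -> R)} :=
  [pred f | `[< is_lipschitz f /\ f o = 0 >]].

Record lip0 := Lip0 {
  lip0_fun :> E -> R;
  _ : lip0_fun \in lip0_pred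
}.

HB.instance Definition _ := [isSub for lip0_fun].
HB.instance Definition _ := [Choice of lip0 by <:].

Lemma lip0_lipschitz (f : lip0) : is_lipschitz f.
Proof. by case: f => f /= /asboolP[]. Qed.

Lemma lip0_base (f : lip0) : f o = 0.
Proof. by case: f => f /= /asboolP[]. Qed.

Lemma lip0_submod_closed : submod_closed lip0_pred.
Proof.
split=> [|a f g].
  apply/asboolP; split=> //.
  by exists 0 => x y; rewrite subrr normr0 mul0r.
move=> /asboolP[[K fK] f0] /asboolP[[L gL] g0].
apply/asboolP; split; last first.
  by rewrite -[LHS]/(a * f o + g o) f0 g0 mulr0 addr0.
exists (`|a| * K + L) => x y.
rewrite -[X in `|X|]/(a * f x + g x - (a * f y + g y)).
rewrite (_ : _ - _ = a * (f x - f y) + (g x - g y)); last by ring.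
rewrite (le_trans (ler_normD _ _))// mulrDl lerD// normrM -mulrA.
by rewrite ler_wpM2l.
Qed.

HB.instance Definition _ :=
  GRing.isSubmodClosed.Build R (E -> R) lip0_pred lip0_submod_closed.
HB.instance Definition _ := [SubChoice_isSubLmodule of lip0 by <:].

Definition lip0_ratios (f : lip0) : set R :=
  [set r | exists x y : E, x != y /\ r = `|f x - f y| / mdist x y].

(* [sup] is total, with value 0 on a set that is empty or has no upper bound;
   [lip0_ratios f] is bounded above, and nonempty as soon as E has two
   points. *)
Definition lip0_norm (f : lip0) : R := sup (lip0_ratios f).

Lemma lip0_ratios_ub (f : lip0) : has_ubound (lip0_ratios f).
Proof.
have [K fK] := lip0_lipschitz f; exists K => _ [x [y [xy ->]]].
by rewrite ler_pdivrMr// mdist_gt0.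
Qed.

Lemma lip0_norm_ub (f : lip0) (x y : E) :
  `|f x - f y| <= lip0_norm f * mdist x y.
Proof.
have [->|xy] := eqVneq x y; first by rewrite subrr normr0 mdistxx mulr0.
rewrite -ler_pdivrMr ?mdist_gt0//.
by apply: ub_le_sup; [exact: lip0_ratios_ub|exists x, y].
Qed.

Lemma lip0_norm_le (f : lip0) (M : R) : 0 <= M ->
  (forall x y, `|f x - f y| <= M * mdist x y) -> lip0_norm f <= M.
Proof.
move=> M0 fM; have [r0|/set0P r0] := eqVneq (lip0_ratios f) set0.
  by rewrite /lip0_norm r0 sup0.
apply: ge_sup => // _ [x [y [xy ->]]].
by rewrite ler_pdivrMr ?mdist_gt0.
Qed.

Lemma lip0_norm_ge0 (f : lip0) : 0 <= lip0_norm f.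
Proof.
have [r0|/set0P [r rf]] := eqVneq (lip0_ratios f) set0.
  by rewrite /lip0_norm r0 sup0.
apply: (@le_trans _ _ r); last by apply: ub_le_sup => //; exact: lip0_ratios_ub.
by case: rf => x [y [_ ->]]; rewrite divr_ge0// mdist_ge0.
Qed.

Lemma lip0_normD (f g : lip0) : lip0_norm (f + g) <= lip0_norm f + lip0_norm g.
Proof.
apply: lip0_norm_le => [|x y]; first by rewrite addr_ge0// lip0_norm_ge0.
rewrite -[X in `|X|]/(f x + g x - (f y + g y)) opprD addrACA.
by rewrite (le_trans (ler_normD _ _))// mulrDl lerD// lip0_norm_ub.
Qed.

Let lip0_normZ_le (l : R) (f : lip0) : lip0_norm (l *: f) <= `|l| * lip0_norm f.
Proof.
apply: lip0_norm_le => [|x y]; first by rewrite mulr_ge0// lip0_norm_ge0.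
rewrite -[X in `|X|]/(l * f x - l * f y) -mulrBr normrM -mulrA.
by rewrite ler_wpM2l// lip0_norm_ub.
Qed.

Lemma lip0_normZ (l : R) (f : lip0) : lip0_norm (l *: f) = `|l| * lip0_norm f.
Proof.
apply/eqP; rewrite eq_le lip0_normZ_le/=.
have [->|l0] := eqVneq l 0; first by rewrite normr0 mul0r lip0_norm_ge0.
rewrite -ler_pdivlMl ?normr_gt0// -normfV -[in leLHS](scalerK l0 f).
exact: lip0_normZ_le.
Qed.

Lemma lip0_norm0_eq0 (f : lip0) : lip0_norm f = 0 -> f = 0.
Proof.
move=> f0; apply/val_inj/funext => x /=.
have := lip0_norm_ub f x o.
by rewrite f0 mul0r lip0_base subr0 normr_le0 => /eqP.
Qed.

HB.instance Definition _ :=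
  Lmodule_isNormed.Build R lip0 lip0_normD lip0_normZ lip0_norm0_eq0.

Lemma lip0_cauchy_pt (F : set_system lip0) (x : E) : ProperFilter F ->
  cauchy F -> cvg ((fun f : lip0 => f x) @ F).
Proof.
move=> FF /cauchyP Fc; apply: cauchy_cvg; apply: cauchy_exP => e e0.
have d0 : 0 < mdist x o + 1 by rewrite ltr_wpDl// mdist_ge0.
have [h hF] := Fc (e / (mdist x o + 1)) (divr_gt0 e0 d0).
exists (h x); change (F [set g : lip0 | ball (h x) e (g x)]).
apply: filterS hF => g; rewrite -!ball_normE/= => hg.
have := lip0_norm_ub (h - g) x o.
rewrite -[X in `|X|]/(h x - g x - (h o - g o)) !lip0_base subrr subr0.
move=> /le_lt_trans; apply; rewrite -[lip0_norm _]/(`|h - g|).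
apply: (@le_lt_trans _ _ (`|h - g| * (mdist x o + 1))).
  by rewrite ler_wpM2l// lerDl.
by rewrite -ltr_pdivlMr.
Qed.

Lemma lip0_complete (F : set_system lip0) :
  ProperFilter F -> cauchy F -> cvg F.
Proof.
move=> FF /[dup] Fc /cauchyP Fe; pose l x := lim ((fun f : lip0 => f x) @ F).
have lP x : (fun f : lip0 => f x) @ F --> l x by exact: lip0_cauchy_pt.
have near_l (e : R) (h : lip0) : F (ball h e) ->
    forall x y, `|(h x - l x) - (h y - l y)| <= e * mdist x y.
  move=> hF x y; apply: (@cvgr_to_le _ F _ _
      (fun g : lip0 => `|(h x - g x) - (h y - g y)|)).
    by apply: cvg_norm; apply: cvgB; apply: cvgB => //; exact: cvg_cst.
  apply: filterS hF => g.
  rewrite -ball_normE/= => /ltW hg.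
  apply: le_trans (lip0_norm_ub (h - g) x y) _.
  by rewrite ler_wpM2r// mdist_ge0.
have l_lip0 : l \in lip0_pred.
  apply/asboolP; split; last first.
    apply: cvg_lim => //; under eq_fun do rewrite lip0_base.
    exact: cvg_cst.
  have [h hF] := Fe 1 ltr01; have [K hK] := lip0_lipschitz h.
  exists (K + 1) => x y.
  rewrite (_ : l x - l y = (h x - h y) - ((h x - l x) - (h y - l y))); last by ring.
  rewrite (le_trans (ler_normB _ _))// mulrDl lerD//.
  exact: near_l hF _ _.
apply/cvg_ex; exists (Lip0 l_lip0); apply/cvgrPdist_le => e e0.
have e20 : 0 < e / 2 by rewrite divr_gt0.
have [h hF] := Fe (e / 2) e20.
have hl : `|h - Lip0 l_lip0| <= e / 2.
  by apply: lip0_norm_le => [|x y]; [exact: ltW|exact: near_l hF x y].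
apply: filterS hF => g; rewrite -ball_normE/= => /ltW hg.
rewrite (_ : _ - g = (h - g) - (h - Lip0 l_lip0)); last first.
  by rewrite opprB [RHS]addrC addrA subrK.
by rewrite (le_trans (ler_normB _ _))// [leRHS]splitr lerD.
Qed.

HB.instance Definition _ := Uniform_isComplete.Build lip0 lip0_complete.

(* The set SA(E) of functions attaining their norm in the strong sense. *)
Definition strongly_attaining : set lip0 :=
  [set f : lip0 | exists x y : E, x != y /\ `|f| = `|f x - f y| / mdist x y].

Definition local_pointed_metric : Prop :=
  forall (e : R) (f : lip0), 0 < e ->
    exists t1 t2 : E, [/\ t1 != t2, mdist t1 t2 < e &
      (f t2 - f t1) / mdist t1 t2 > `|f| - e].

End lip0.

Arguments strongly_attaining {R E} o.
Arguments local_pointed_metric {R E} o.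

Section weak_topology.
Context {R : realType} (V : normedModType R).

Definition continuous_dual : Type := {phi : {linear V -> R^o} | continuous phi}.

(* V with the coarsest topology making every element of its dual continuous. *)
Definition weak_space : Type := sup_topology (fun phi : continuous_dual =>
  Topological.on (initial_topology (sval phi : V -> R))).

HB.instance Definition _ := Topological.on weak_space.

Lemma weak_cvgP (F : set_system V) (x : V) : Filter F ->
  F --> (x : weak_space) <->
  forall phi : {linear V -> R^o}, continuous phi -> phi @ F --> phi x.
Proof.
move=> FF; rewrite cvg_sup; split=> [Fx phi phic|Fx [phi phic]].
  move=> A Ax; apply: (Fx (exist _ phi phic)).
  exact: (@initial_continuous V R phi x A Ax).
move=> A [B [[C oC <-] Cx] CA]; apply: filterS CA _.
exact: (Fx phi phic C (open_nbhs_nbhs (conj oC Cx))).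
Qed.

End weak_topology.

(* Main.v *)
(** With [L] the norm of [g], [K = 2 L + 1] and [x != y], the function
    [max(g, g x + K (d(x, y) - d(y, .)))] is [K]-Lipschitz, has slope exactly
    [K] between [x] and [y], and agrees with [g] outside the ball of centre [y]
    and radius [3 d(x, y)].  A local space has no isolated point, so such
    perturbations of [g] can be made in a sequence of pairwise disjoint balls.
    Their differences with [g] are bounded and have disjoint supports, so finite
    signed sums of them are uniformly bounded, and every bounded functional is
    absolutely summable, hence tends to 0, along them. *)
Require Import Defs.
From HB Require Import structures.
From mathcomp Require Import all_boot all_order all_algebra.
From mathcomp Require Import all_classical all_reals all_analysis.
From mathcomp Require Import ring lra.

Set Implicit Arguments.
Unset Strict Implicit.
Unset Printing Implicit Defensive.

Import Order.TTheory GRing.Theory Num.Theory.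
Import numFieldNormedType.Exports.

Local Open Scope classical_set_scope.
Local Open Scope ring_scope.

(** Applied at a fixed point, where at most one function of a disjointly supported family is
    nonzero. *)
Lemma sum_at_most_one_le (R : numDomainType) (n : nat) (P : pred nat) (c : R) :
  0 <= c -> (forall i j, P i -> P j -> i = j) ->
  \sum_(i < n) (if P i then c else 0) <= c.
Proof.
move=> c0 P1; case: (pickP (fun i : 'I_n => P i)) => [i Pi|P0]; last first.
  by rewrite big1// => i _; rewrite P0.
rewrite (bigD1 i)//= Pi big1 ?addr0// => j /eqP ji.
by case: ifP => // Pj; case: ji; apply/val_inj/P1.
Qed.

Section lip0_facts.
Context {R : realType} {E : metricType R} {o : E}.
Implicit Types (f g : lip0 o) (x y t : E).

Lemma lip0_dist_le f x y : `|f x - f y| <= `|f| * mdist x y.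
Proof. exact: lip0_norm_ub. Qed.

Lemma lip0_sumE (I : Type) (s : seq I) (F : I -> lip0 o) t :
  (\sum_(i <- s) F i : lip0 o) t = \sum_(i <- s) F i t.
Proof. by elim/big_rec2: _ => //= i u v _ <-. Qed.

Lemma lip0_exists (F : E -> R) (K : R) : F o = 0 ->
  (forall x y, `|F x - F y| <= K * mdist x y) ->
  exists2 f : lip0 o, (f : E -> R) = F & 0 <= K -> `|f| <= K.
Proof.
move=> Fo FK; have FP : F \in lip0_pred o by apply/asboolP; split=> //; exists K.
by exists (Lip0 FP) => // K0; apply: lip0_norm_le.
Qed.

(** The condition on [o] puts the base point where [g] is left unchanged, so the perturbed function
    still vanishes there. *)
Lemma strongly_attaining_perturbation g x y :
  x != y -> 3 * mdist x y <= mdist y o ->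
  exists f, [/\ f \in strongly_attaining o, `|f| <= 2 * `|g| + 1 &
    forall t, 3 * mdist x y <= mdist y t -> f t = g t].
Proof.
move=> xy yo; have d0 : 0 < mdist x y by rewrite mdist_gt0.
have L0 : 0 <= `|g| := normr_ge0 _.
have gL := lip0_dist_le g.
set K : R := 2 * `|g| + 1.
have K0 : 0 <= K by rewrite /K; lra.
pose c t := g x + K * (mdist x y - mdist y t).
pose F t := Num.max (g t) (c t).
(* With [d = mdist x y] and [r = mdist y t], it suffices that [|g| (r + d) <= K (r - d)]. This holds
   because [r >= 3 d] gives [r - d >= (r + d) / 2], and [K / 2 >= |g|]. *)
have FE t : 3 * mdist x y <= mdist y t -> F t = g t.
  move=> yt; apply/max_idPl; rewrite /c /K.
  have := gL x t; rewrite ler_norml => /andP[_ gxt].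
  have xyt := metric_triangle x y t.
  by nra.
have cK s t : `|c s - c t| <= K * mdist s t.
  have := metric_triangle y s t; have := metric_triangle y t s.
  rewrite (metric_sym t s) /c => h1 h2.
  rewrite (_ : _ - _ = K * (mdist y t - mdist y s)); last by ring.
  rewrite normrM ger0_norm// ler_wpM2l// ler_norml.
  by apply/andP; split; lra.
have FK s t : `|F s - F t| <= K * mdist s t.
  have gK : `|g s - g t| <= K * mdist s t.
    by apply: le_trans (gL s t) _; rewrite ler_wpM2r ?mdist_ge0// /K; lra.
  move: gK (cK s t); rewrite /F !ler_norml => /andP[g1 g2] /andP[c1 c2].
  by case: (leP (g s) (c s)); case: (leP (g t) (c t)) => ? ?;
    apply/andP; split; lra.
have [||f fF fK] := @lip0_exists F K; [by rewrite FE// lip0_base|by []|].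
exists f; split; [|exact: fK|by move=> t yt; rewrite fF FE].
have Fx : F x = g x by rewrite /F /c (metric_sym y) subrr mulr0 addr0 maxxx.
have Fy : F y = g x + K * mdist x y.
  rewrite /F /c mdistxx subr0; apply/max_idPr; rewrite /K.
  have := gL x y; rewrite ler_norml => /andP[gxy _].
  by nra.
have slope : `|f x - f y| / mdist x y = K.
  rewrite fF Fx Fy opprD addNKr normrN ger0_norm ?mulfK ?gt_eqF//.
  by rewrite mulr_ge0// ltW.
apply/mem_set; exists x, y; split=> //; rewrite slope; apply/eqP.
rewrite eq_le fK//= -slope ler_pdivrMr//.
exact: lip0_dist_le.
Qed.

Section disjoint_supports.
Variables (h : nat -> lip0 o) (M : R).
Hypothesis h_disj : forall i j t, h i t != 0 -> h j t != 0 -> i = j.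
Hypothesis h_le : forall i, `|h i| <= M.

(** In the difference of the values at [s] and [t], only the index active at [s] and the one active
    at [t] contribute, each at most [M * mdist s t]; hence the bound is independent of [n]. *)
Lemma disjoint_sum_norm_le (a : nat -> R) n :
  (forall i, `|a i| <= 1) -> `|\sum_(i < n) a i *: h i| <= M + M.
Proof.
move=> a1; have M0 : 0 <= M by exact: le_trans (normr_ge0 _) (h_le 0%N).
apply: lip0_norm_le => [|s t]; first by rewrite addr_ge0.
have Mst : 0 <= M * mdist s t by rewrite mulr_ge0// mdist_ge0.
rewrite !lip0_sumE -sumrB mulrDl.
apply: le_trans (ler_norm_sum _ _ _) _.
have hM u := @sum_at_most_one_le R n (fun i => h i u != 0) _ Mst
  (fun i j => @h_disj i j u).
apply: le_trans (lerD (hM s) (hM t)); rewrite -big_split/= ler_sum// => i _.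
rewrite -[X in `|X|]/(a i * h i s - a i * h i t) -mulrBr normrM.
apply: (@le_trans _ _ `|h i s - h i t|); first by rewrite ler_piMl.
have hM' : `|h i s - h i t| <= M * mdist s t.
  by apply: le_trans (lip0_dist_le _ _ _) _; rewrite ler_wpM2r// mdist_ge0.
move: hM'; have [->|_] := eqVneq (h i s) 0; have [->|_] := eqVneq (h i t) 0;
  rewrite ?subrr ?normr0 ?addr0 ?add0r//= => hM'.
by rewrite (le_trans hM')// lerDl.
Qed.

Lemma disjoint_weakly_null (phi : {linear lip0 o -> R^o}) :
  continuous phi -> (fun n => phi (h n)) @ \oo --> (0 : R).
Proof.
move=> /linear_bounded_continuous/linear_boundedP.
move=> /pinfty_ex_gt0[C C0 phiC].
suff : (fun n => `|phi (h n)|) @ \oo --> (0 : R) by move/norm_cvg0P.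
apply: cvg_series_cvg_0; apply: nondecreasing_is_cvgn.
  by apply: nondecreasing_series => n _ _; exact: normr_ge0.
exists (C * (M + M)) => _ [n _ <-].
(* These signs turn the partial sum of the [|phi (h i)|] into [phi] of a single signed sum. *)
pose a i := Num.sg (phi (h i) : R).
have a1 i : `|a i| <= 1 by rewrite /a normr_sg lern1 leq_b1.
rewrite /series/= big_mkord.
rewrite (_ : \sum_(i < n) _ = phi (\sum_(i < n) a i *: h i)); last first.
  rewrite linear_sum; apply: eq_bigr => i _.
  by rewrite linearZ/= -[RHS]/(a i * (phi (h i) : R)) normrEsg.
apply: le_trans (ler_norm _) _; apply: le_trans (phiC _) _.
by rewrite ler_pM2l// disjoint_sum_norm_le.
Qed.

End disjoint_supports.

(* At an isolated point [x], a multiple of the indicator of [x], shifted to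
   vanish at [o], has slope 0 between any two close points. *)
Lemma local_no_isolated : (exists x, x != o) -> local_pointed_metric o ->
  forall x (e : R), 0 < e -> exists2 y, y != x & mdist x y < e.
Proof.
move=> [p po] E_local x e e0; apply: contrapT => /forall2NP isol.
have far y : y != x -> e <= mdist x y.
  by move=> yx; have [/(_ yx)//|/negP] := isol y; rewrite -leNgt.
have [z zx] : exists z, z != x.
  have [->|] := eqVneq x o; first by exists p.
  by rewrite eq_sym; exists o.
pose b t : R := if t == x then e else 0.
have bK s t : `|b s - b o - (b t - b o)| <= 1 * mdist s t.
  rewrite mul1r /b (_ : forall u v w : R, u - v - (w - v) = u - w); last first.
    by move=> u v w; ring.
  have [->|sx] := eqVneq s x; have [->|tx] := eqVneq t x.
  - by rewrite subrr normr0 mdist_ge0.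
  - by rewrite subr0 gtr0_norm// far.
  - by rewrite sub0r normrN gtr0_norm// metric_sym far.
  - by rewrite subr0 normr0 mdist_ge0.
have [||f fE _] := @lip0_exists (fun t => b t - b o) 1; [by rewrite subrr|by []|].
have f0 : 0 < `|f|.
  rewrite normr_gt0; apply/eqP => f0.
  have : f x - f z = 0 by rewrite f0 subrr.
  by rewrite fE /b eqxx (negbTE zx); move: e0; lra.
(* The bound [e] keeps both points away from [x], where the slope is 0; the bound [|f|] makes the
   slope given by locality positive. *)
have [|t1 [t2 [t12 t12e]]] := E_local (Num.min e `|f|) f.
  by rewrite lt_min e0.
move: t12e; rewrite lt_min => /andP[t12e _].
have t1x : t1 != x.
  by apply: contraTneq t12e => t1x; rewrite -leNgt t1x far// -t1x eq_sym.
have t2x : t2 != x.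
  by apply: contraTneq t12e => t2x; rewrite -leNgt t2x metric_sym far// -t2x.
rewrite fE /b (negbTE t1x) (negbTE t2x) subrr mul0r subr_lt0.
by rewrite lt_min ltxx andbF.
Qed.

End lip0_facts.

(** The factor 4 is large enough for the balls of centre [y n] and radius [mdist (y n) o / 2] to be
    pairwise disjoint. *)
Lemma geometric_sequence (R : realType) (E : metricType R) (o : E) :
  (forall e : R, 0 < e -> exists2 y, y != o & mdist o y < e) ->
  exists y : nat -> E, (forall n, y n != o) /\
    (forall i j, (i < j)%N -> 4 * mdist (y j) o < mdist (y i) o).
Proof.
move=> near_o; have [y0 y0o _] := near_o 1 ltr01.
(* The premise [y != o] makes the relation total, as dependent choice requires: at [o] it holds
   vacuously. *)
pose S y z := y != o -> z != o /\ 4 * mdist z o < mdist y o.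
have S_total y : {z | S y z}.
  apply: cid; have [->|yo] := eqVneq y o; first by exists o; rewrite /S eqxx.
  have /near_o[z zo oz] : 0 < mdist y o / 4 by rewrite divr_gt0// mdist_gt0.
  by exists z => _; split=> //; rewrite metric_sym; lra.
have [y [y_0 yS]] := dependent_choice S_total y0.
have yo n : y n != o by elim: n => [|n /yS[]//]; rewrite y_0.
exists y; split=> // i; elim=> // j IHj; rewrite ltnS leq_eqVlt.
have [_ yj] := yS j (yo j); case/predU1P => [->//|/IHj yij].
have : 0 <= mdist (y j) o by exact: mdist_ge0.
by lra.
Qed.

Theorem theorem2p6 (R : realType) (E : metricType R) (o : E)
    (E_nontrivial : exists x : E, x != o)
    (E_local : local_pointed_metric o) :
  forall g : lip0 o, exists u : nat -> lip0 o,
    (forall n, u n \in strongly_attaining o) /\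
    ((fun n => u n : weak_space (lip0 o)) @ \oo --> (g : weak_space (lip0 o))).
Proof.
move=> g; have isol := local_no_isolated E_nontrivial E_local.
have [y [yo y4]] := geometric_sequence (isol o).
have s0 n : 0 < mdist (y n) o by rewrite mdist_gt0.
have /choice[u uP] n : exists f : lip0 o,
    [/\ f \in strongly_attaining o, `|f| <= 2 * `|g| + 1 &
      forall t, mdist (y n) o / 2 <= mdist (y n) t -> f t = g t].
  (* With [mdist x (y n)] below a sixth of [mdist (y n) o], the perturbation radius
     [3 * mdist x (y n)] is below half of it. *)
  have /isol-/(_ (y n))[x xy yx] : 0 < mdist (y n) o / 6 by rewrite divr_gt0.
  have := s0 n; rewrite metric_sym in yx => sn.
  have [|f [fSA fle fg]] := @strongly_attaining_perturbation R E o g x (y n) xy.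
    by lra.
  by exists f; split=> // t yt; apply: fg; lra.
exists u; split=> [n|]; first by have [] := uP n.
apply/weak_cvgP => phi phic.
pose h n := u n - g.
have h_near n t : h n t != 0 -> mdist (y n) t < mdist (y n) o / 2.
  rewrite ltNge; apply: contraNN => yt; have [_ _ ug] := uP n.
  by rewrite -[h n t]/(u n t - g t) ug// subrr.
(* A common point [t] would give [s_i < s_i / 2 + 3 s_j / 2] with [s_k = mdist (y k) o], against
   [4 s_j < s_i]. *)
have h_lt i j t : (i < j)%N -> h i t != 0 -> h j t != 0 -> False.
  move=> /y4 ij /h_near it /h_near jt.
  have := metric_triangle (y i) t o; have := metric_triangle t (y j) o.
  by have := s0 j; rewrite (metric_sym t (y j)); lra.
have h_disj i j t : h i t != 0 -> h j t != 0 -> i = j.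
  by move=> hi hj; have [ij|ij|//] := ltngtP i j;
    [case: (h_lt i j t)|case: (h_lt j i t)].
have h_le n : `|h n| <= 3 * `|g| + 1.
  by have [_ un _] := uP n; apply: le_trans (ler_normB _ _) _; lra.
have phih := disjoint_weakly_null h_disj h_le phic.
have phiuE : (fun n => (phi (h n) : R^o) + phi g) = phi \o u.
  by apply/funext => n /=; rewrite linearB subrK.
have : (phi \o u) @ \oo --> (0 + phi g : R^o).
  by rewrite -phiuE; apply: cvgD phih _; exact: cvg_cst.
by rewrite add0r.
Qed.
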